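(* Let $\mathcal{D}$ be a quad-graph with an edge labelling $\alpha:E(\mathcal{D})\to\mathbb{C}$, and let the equation $Q(f,f_1,f_{12},f_2;\alpha_1,\alpha_2)=0$ be 3D consistent. Then for any solution $f:V(\mathcal{D})\to\mathbb{C}$ of this equation on $\mathcal{D}$ there is a two-parameter family of solutions $f^+:V(\mathcal{D})\to\mathbb{C}$ of the same equation on $\mathcal{D}$, satisfying $$Q(f,f_i,f_i^+,f^+;\alpha_i,\lambda)=0$$ for all edges $(f,f_i)\in E(\mathcal{D})$, where $\alpha_i$ is the label of this edge. Such a solution $f^+$ is called a Bäcklund transform of $f$, and is determined by its value at one vertex of $\mathcal{D}$ and by the parameter $\lambda$.
   Context: A quad-graph $\mathcal{D}$ is a strongly regular polytopal cell decomposition of a surface with all faces quadrilateral; $V(\mathcal{D})$, $E(\mathcal{D})$, $F(\mathcal{D})$ are its vertices, edges and faces. A labelling $\alpha:E(\mathcal{D})\to\mathbb{C}$ is a function taking equal values on opposite edges of each quadrilateral face. Vertices and the values of the field at them are denoted by the same letter; $f^+$ at a vertex denotes the value of the new solution at that vertex. $Q(x,u,y,v;\alpha,\beta)$ is a polynomial of degree 1 in each of $x,u,y,v$ (coefficients depending on $\alpha,\beta$), with the symmetry $Q(x,u,y,v;\alpha,\beta)=\varepsilon Q(x,v,y,u;\beta,\alpha)=\sigma Q(u,y,v,x;\beta,\alpha)$, $\varepsilon,\sigma\in\{\pm1\}$, and it is required that $Q=0$ be uniquely solvable for any one of the four fields given the other three. The equation on $\mathcal{D}$: $f:V(\mathcal{D})\to\mathbb{C}$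 is a solution if for every face with cyclically ordered vertices $f,f_1,f_{12},f_2$, where the edges $(f,f_1),(f_2,f_{12})$ carry the label $\alpha_1$ and $(f,f_2),(f_1,f_{12})$ carry $\alpha_2$, one has $Q(f,f_1,f_{12},f_2;\alpha_1,\alpha_2)=0$. 3D consistency: the equation can be consistently imposed on all faces of a combinatorial cube whose edges parallel to the $i$-th direction all carry the parameter $\alpha_i$. That is, given initial values $f,f_1,f_2,f_3$, define $f_{ij}$ ($i\neq j$) by $Q(f,f_i,f_{ij},f_j;\alpha_i,\alpha_j)=0$; then the three equations $Q(f_i,f_{ij},f_{123},f_{ik};\alpha_j,\alpha_k)=0$ (one for each $i\in\{1,2,3\}$, with $\{i,j,k\}=\{1,2,3\}$) for $f_{123}$ lead to identical results.
   Formalization: The surface of the quad-graph is assumed simply connected (false on the 5×5 torus grid with Q=x+u+y+v, f=0); unique solvability of Q=0 is required only at the faces carrying f and at the vertical quadrilaterals met from the chosen initial value, which the literal requirement implies. *)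

(* Defs.v *)
From HB Require Import structures.
From Stdlib Require Import Relation_Operators.
From mathcomp Require Import all_boot all_order all_algebra.
From mathcomp Require Import boolp classical_sets cardinality reals.
From mathcomp Require Import complex mpoly.
Set Implicit Arguments.
Unset Strict Implicit.
Unset Printing Implicit Defensive.
Import GRing.Theory.
Local Open Scope ring_scope.

(** A strongly regular cell decomposition of a connected surface (boundary and
    noncompactness allowed) into quadrilaterals, given by its combinatorics:
    [face x u y v] says that [x, u, y, v] are the vertices of a face in cyclic
    order, in either orientation and from any starting corner.  Strong
    regularity makes every cell determined by its set of vertices, so that an
    edge is a pair of vertices. *)
Record quad_graph (V : countType) := QuadGraph {
  edge : rel V;
  face : V -> V -> V -> V -> Prop;
  face_rot : forall x u y v, face x u y v -> face u y v x;
  face_refl : forall x u y v, face x u y v -> face x v y u;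
  (* closed faces are embedded quadrilaterals *)
  face_uniq : forall x u y v, face x u y v -> uniq [:: x; u; y; v];
  edgeE : forall x u, edge x u <-> exists y v, face x u y v;
  (* strong regularity (two closed cells meet in one common cell or not at
     all): opposite vertices of a face are not joined by an edge, and distinct
     faces do not share two opposite vertices *)
  face_diag : forall x u y v, face x u y v -> ~~ edge x y;
  face_inter : forall x u y v u' v', face x u y v -> face x u' y v' ->
    (u' = u /\ v' = v) \/ (u' = v /\ v' = u);
  (* an edge lies in at most two faces *)
  edge_two_faces : forall x u y v y' v' y'' v'',
    face x u y v -> face x u y' v' -> face x u y'' v'' ->
    v = v' \/ v = v'' \/ v' = v'';
  (* the link of each vertex is nonempty, finite and connected; with
     [edge_two_faces] it is a cycle or, on the boundary, a path *)
  link_nonempty : forall x, exists u, edge x u;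
  link_finite : forall x, exists s : seq V, forall u, edge x u -> u \in s;
  link_connected : forall x u u', edge x u -> edge x u' ->
    clos_refl_trans V (fun a b => exists y, face x a y b) u u';
  graph_connected : forall x y, exists p, path edge x p /\ last x p = y
}.

(** Combinatorial homotopy, with fixed endpoints, of edge walks. *)
Inductive homotopic (V : countType) (D : quad_graph V) :
    seq V -> seq V -> Prop :=
| homotopic_refl p : homotopic D p p
| homotopic_sym p q : homotopic D p q -> homotopic D q p
| homotopic_trans p q r :
    homotopic D p q -> homotopic D q r -> homotopic D p r
| homotopic_backtrack p q x u :
    edge D x u -> homotopic D (p ++ x :: q) (p ++ [:: x, u, x & q])
| homotopic_face p q x u y v :
    face D x u y v ->
    homotopic D (p ++ [:: x, u, y & q]) (p ++ [:: x, v, y & q]).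

Definition simply_connected (V : countType) (D : quad_graph V) : Prop :=
  forall (x : V) (p : seq V),
    path (edge D) x p -> last x p = x -> homotopic D (x :: p) [:: x].

Definition labelling (R : realType) (V : countType) (D : quad_graph V)
    (alpha : V -> V -> R[i]) : Prop :=
  (forall x u, edge D x u -> alpha x u = alpha u x) /\
  (forall x u y v, face D x u y v -> alpha x u = alpha v y).

(** [Q a b] is the polynomial Q( . , . , . , . ; a, b). *)
Definition quad_poly (R : realType) := R[i] -> R[i] -> {mpoly (R[i])[4]}.

Definition qval (R : realType) (Q : quad_poly R) (x u y v a b : R[i]) : R[i] :=
  (Q a b).@[tnth [tuple x; u; y; v]].

Definition multiaffine (R : realType) (Q : quad_poly R) : Prop :=
  forall a b (m : 'X_{1..4}), m \in msupp (Q a b) -> forall i, (m i <= 1)%N.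

Definition quad_symmetric (R : realType) (Q : quad_poly R) : Prop :=
  exists eps sigma : R[i],
    [/\ eps = 1 \/ eps = -1, sigma = 1 \/ sigma = -1 &
      forall x u y v a b,
        qval Q x u y v a b = eps * qval Q x v y u b a /\
        qval Q x u y v a b = sigma * qval Q u y v x b a].

(** Q = 0 is uniquely solvable for any one of the four fields, given the values
    of the other three at this quadrilateral. *)
Definition solvable_at (R : realType) (Q : quad_poly R)
    (x u y v a b : R[i]) : Prop :=
  [/\ exists! z, qval Q z u y v a b = 0,
      exists! z, qval Q x z y v a b = 0,
      exists! z, qval Q x u z v a b = 0 &
      exists! z, qval Q x u y z a b = 0].

(** Required at all complex values, unique solvability forces the coefficient
    of each field, a polynomial without zeros, to be constant, which leaves
    only equations of degree one in all fields jointly.  In general a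
    multiaffine equation is solvable away from the zeros of these coefficients,
    so unique solvability is imposed below on the quadrilaterals that occur;
    see [solvable_regular] and [solvable_pole_free]. *)
Definition uniquely_solvable (R : realType) (Q : quad_poly R) : Prop :=
  forall x u y v a b, solvable_at Q x u y v a b.

(** The three equations for [f123] lead to identical results: a value uniquely
    determined by one of them satisfies all three.  If Q is uniquely solvable
    everywhere, this says that their unique solutions agree. *)
Definition consistent3D (R : realType) (Q : quad_poly R) : Prop :=
  forall (a1 a2 a3 f f1 f2 f3 f12 f13 f23 : R[i]),
    unique (fun z => qval Q f f1 z f2 a1 a2 = 0) f12 ->
    unique (fun z => qval Q f f1 z f3 a1 a3 = 0) f13 ->
    unique (fun z => qval Q f f2 z f3 a2 a3 = 0) f23 ->
    let E1 := fun z => qval Q f1 f12 z f13 a2 a3 = 0 in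
    let E2 := fun z => qval Q f2 f12 z f23 a1 a3 = 0 in
    let E3 := fun z => qval Q f3 f13 z f23 a1 a2 = 0 in
    forall f123, unique E1 f123 \/ unique E2 f123 \/ unique E3 f123 ->
      [/\ E1 f123, E2 f123 & E3 f123].

Definition solution (R : realType) (V : countType) (D : quad_graph V)
    (alpha : V -> V -> R[i]) (Q : quad_poly R) (f : V -> R[i]) : Prop :=
  forall x u y v, face D x u y v ->
    qval Q (f x) (f u) (f y) (f v) (alpha x u) (alpha x v) = 0.

Definition regular (R : realType) (V : countType) (D : quad_graph V)
    (alpha : V -> V -> R[i]) (Q : quad_poly R) (f : V -> R[i]) : Prop :=
  forall x u y v, face D x u y v ->
    solvable_at Q (f x) (f u) (f y) (f v) (alpha x u) (alpha x v).

Definition backlund (R : realType) (V : countType) (D : quad_graph V)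
    (alpha : V -> V -> R[i]) (Q : quad_poly R) (lambda : R[i])
    (f fp : V -> R[i]) : Prop :=
  forall x u, edge D x u ->
    qval Q (f x) (f u) (fp u) (fp x) (alpha x u) lambda = 0.

(** [transported D alpha Q lambda f v0 t v s]: [s] is a value obtained at [v]
    from the value [t] at [v0] by solving the equations of a Baecklund
    transformation successively along some edge walk from [v0] to [v]. *)
Inductive transported (R : realType) (V : countType) (D : quad_graph V)
    (alpha : V -> V -> R[i]) (Q : quad_poly R) (lambda : R[i])
    (f : V -> R[i]) (v0 : V) (t : R[i]) : V -> R[i] -> Prop :=
| transported_start : transported D alpha Q lambda f v0 t v0 t
| transported_step x u s s' :
    transported D alpha Q lambda f v0 t x s -> edge D x u ->
    qval Q (f x) (f u) s' s (alpha x u) lambda = 0 ->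
    transported D alpha Q lambda f v0 t u s'.

(** All the equations met when transporting the initial value [t] at [v0] are
    uniquely solvable in the complex numbers. *)
Definition pole_free (R : realType) (V : countType) (D : quad_graph V)
    (alpha : V -> V -> R[i]) (Q : quad_poly R) (lambda : R[i])
    (f : V -> R[i]) (v0 : V) (t : R[i]) : Prop :=
  forall x u s, transported D alpha Q lambda f v0 t x s -> edge D x u ->
    exists! s', qval Q (f x) (f u) s' s (alpha x u) lambda = 0.

(** On each edge [a s' s + b s' + c s + d = 0], the equation between the values
    [s] of [f+] at [x] and [s'] of [f+] at [u], is an invertible fractional
    linear correspondence; the condition is [a d <> b c]. *)
Definition edge_nondegenerate (R : realType) (V : countType) (D : quad_graph V)
    (alpha : V -> V -> R[i]) (Q : quad_poly R) (lambda : R[i])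
    (f : V -> R[i]) : Prop :=
  forall x u, edge D x u ->
    let q := fun s' s => qval Q (f x) (f u) s' s (alpha x u) lambda in
    q 1 1 * q 0 0 <> q 1 0 * q 0 1.

Lemma solvable_regular (R : realType) (V : countType) (D : quad_graph V)
    (alpha : V -> V -> R[i]) (Q : quad_poly R) (f : V -> R[i]) :
  uniquely_solvable Q -> regular D alpha Q f.
Proof. by move=> solQ x u y v _; apply: solQ. Qed.

Lemma solvable_pole_free (R : realType) (V : countType) (D : quad_graph V)
    (alpha : V -> V -> R[i]) (Q : quad_poly R) (lambda : R[i])
    (f : V -> R[i]) (v0 : V) (t : R[i]) :
  uniquely_solvable Q -> pole_free D alpha Q lambda f v0 t.
Proof.
move=> solQ x u s _ _.
by case: (solQ (f x) (f u) 0 s (alpha x u) lambda) => _ _ + _.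
Qed.

(* Main.v *)
(** Put [f] on a copy of the quad-graph and [f+] on a second copy above it: each
    face spans a cube with vertical label lambda, and the equations on the side
    faces transport a value of [f+] along the edges.  Consistency around the
    cube says that transport along either half of the boundary of a face agrees,
    and the symmetry of Q that going back along an edge undoes the transport, so
    transport depends only on the homotopy class of a walk, i.e. on its
    endpoints; the top face of each cube shows that the resulting [f+] is a
    solution.  Transport is moreover injective on nondegenerate edges and has at
    most one pole per edge, so that each of the countably many walks excludes at
    most one initial value. *)
Require Import Defs.
From mathcomp Require Import all_boot all_order all_algebra.
From mathcomp Require Import boolp classical_sets cardinality reals.
From mathcomp Require Import complex mpoly.
From mathcomp Require Import ring.
Set Implicit Arguments.
Unset Strict Implicit.
Unset Printing Implicit Defensive.
Import GRing.Theory.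
Local Open Scope ring_scope.
Local Open Scope classical_set_scope.

(** * Edges of a quad-graph *)

Section QuadGraph.
Context {V : countType} (D : quad_graph V).

Lemma face_edge x u y v : face D x u y v -> edge D x u.
Proof. by move=> h; apply/edgeE; exists y, v. Qed.

Lemma edge_sym x u : edge D x u -> edge D u x.
Proof.
by case/edgeE=> y [v h]; apply: face_edge (face_refl (face_rot h)).
Qed.

End QuadGraph.

(** Each monomial has exponent 0 or 1 in variable [i], so the value is affine in [w i], interpolated
    from its values at 0 and 1. *)
Lemma meval_affine (K : comNzRingType) n (p : {mpoly K[n]}) (i : 'I_n)
    (w w0 w1 : 'I_n -> K) :
  (forall m, m \in msupp p -> (m i <= 1)%N) ->
  (forall j, j != i -> w0 j = w j) -> (forall j, j != i -> w1 j = w j) ->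
  w0 i = 0 -> w1 i = 1 ->
  p.@[w] = (1 - w i) * p.@[w0] + w i * p.@[w1].
Proof.
move=> le1 e0 e1 w00 w11; rewrite !mevalE !big_distrr -big_split /=.
apply: eq_big_seq => m /le1.
have monE (z : 'I_n -> K) : (forall j, j != i -> z j = w j) ->
    \prod_j z j ^+ m j = z i ^+ m i * \prod_(j | j != i) w j ^+ m j.
  by move=> e; rewrite (bigD1 i) //=; congr (_ * _); apply: eq_bigr => j /e ->.
rewrite !monE // w00 w11 expr1n.
by case: (m i) => [|[|//]] _; rewrite ?expr0 ?expr1 ?expr0n /=; ring.
Qed.

(** * Degenerate bilinear equations in two unknowns *)

Section Bilinear.
Context {K : fieldType}.

(** Here [a], [b], [c], [d] are the values at [(s', s)] = (1,1), (1,0), (0,1), (0,0);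
    [a * d - b * c] equals the determinant formed from the coefficients. An affine function of [s]
    with two zeros vanishes, so the nonzero vector [(1 - s', s')] lies in the kernel of a matrix
    with this determinant. *)
Lemma bilinear_degenerate_l (a b c d s' s1 s2 : K) : s1 != s2 ->
  (1 - s') * ((1 - s1) * d + s1 * c) + s' * ((1 - s1) * b + s1 * a) = 0 ->
  (1 - s') * ((1 - s2) * d + s2 * c) + s' * ((1 - s2) * b + s2 * a) = 0 ->
  a * d = b * c.
Proof.
set k0 := (1 - s') * d + s' * b; set k1 := (1 - s') * c + s' * a.
have E s : (1 - s') * ((1 - s) * d + s * c) + s' * ((1 - s) * b + s * a)
    = k0 + s * (k1 - k0) by rewrite /k0 /k1; ring.
rewrite -subr_eq0 !E => s12 q1 q2.
have k10 : k1 - k0 = 0.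
  apply: (mulfI s12); rewrite mulr0.
  have -> : (s1 - s2) * (k1 - k0)
    = (k0 + s1 * (k1 - k0)) - (k0 + s2 * (k1 - k0)) by ring.
  by rewrite q1 q2 subrr.
have k00 : k0 = 0 by rewrite -q1 k10 mulr0 addr0.
have k11 : k1 = 0 by rewrite -k10 k00 subr0.
apply/eqP; rewrite -subr_eq0; apply/eqP.
(* The multipliers are chosen so that [s'] cancels. *)
have -> : a * d - b * c = (d - b) * k1 + (a - c) * k0 by rewrite /k0 /k1; ring.
by rewrite k00 k11 !mulr0 addr0.
Qed.

(** The hypotheses say that the coefficient of [s'], affine in [s], has two zeros; it vanishes
    identically, giving [a = c] and [b = d]. *)
Lemma bilinear_degenerate_r (a b c d s1 s2 : K) : s1 != s2 ->
  (1 - s1) * b + s1 * a = (1 - s1) * d + s1 * c ->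
  (1 - s2) * b + s2 * a = (1 - s2) * d + s2 * c ->
  a * d = b * c.
Proof.
set B := b - d; set A := (a - c) - B.
have E s : (1 - s) * b + s * a = (1 - s) * d + s * c -> B + s * A = 0.
  move=> e; have -> : B + s * A
    = ((1 - s) * b + s * a) - ((1 - s) * d + s * c) by rewrite /A /B; ring.
  by rewrite e subrr.
rewrite -subr_eq0 => s12 /E q1 /E q2.
have A0 : A = 0.
  apply: (mulfI s12); rewrite mulr0.
  have -> : (s1 - s2) * A = (B + s1 * A) - (B + s2 * A) by ring.
  by rewrite q1 q2 subrr.
have B0 : B = 0 by rewrite -q1 A0 mulr0 addr0.
apply/eqP; rewrite -subr_eq0; apply/eqP.
have -> : a * d - b * c = (A + B) * d - B * c by rewrite /A /B; ring.
by rewrite A0 B0 addr0 !mul0r subrr.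
Qed.

End Bilinear.

(** * Affine dependence and symmetry of the equation *)

Section Multiaffine.
Context {R : realType} (Q : quad_poly R).
Hypothesis affQ : multiaffine Q.

Lemma qval_affine_y x u y v a b :
  qval Q x u y v a b
  = (1 - y) * qval Q x u 0 v a b + y * qval Q x u 1 v a b.
Proof.
have le1 m : m \in msupp (Q a b) -> (m (inord 2) <= 1)%N by move=> /affQ ->.
rewrite /qval (meval_affine (w0 := tnth [tuple x; u; 0; v])
  (w1 := tnth [tuple x; u; 1; v]) le1) ?(tnth_nth 0) ?inordK //=
  => -[[|[|[|[|]]]] lt].
all: by rewrite ?(tnth_nth 0) // -val_eqE /= inordK.
Qed.

Lemma qval_affine_v x u y v a b :
  qval Q x u y v a b
  = (1 - v) * qval Q x u y 0 a b + v * qval Q x u y 1 a b.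
Proof.
have le1 m : m \in msupp (Q a b) -> (m (inord 3) <= 1)%N by move=> /affQ ->.
rewrite /qval (meval_affine (w0 := tnth [tuple x; u; y; 0])
  (w1 := tnth [tuple x; u; y; 1]) le1) ?(tnth_nth 0) ?inordK //=
  => -[[|[|[|[|]]]] lt].
all: by rewrite ?(tnth_nth 0) // -val_eqE /= inordK.
Qed.

End Multiaffine.

Section Symmetry.
Context {R : realType} (Q : quad_poly R).
Hypothesis symQ : quad_symmetric Q.

(** Both sides are, up to sign, [qval Q u y v x b a]. This reflection exchanges the ends of an edge
    and lets a step be undone. *)
Lemma qval_flip x u y v a b :
  qval Q x u y v a b = 0 -> qval Q u x v y a b = 0.
Proof.
case: symQ => eps [sigma [heps hsigma h]] q0.
have [q1 _] := h u x v y a b; have [_ q2] := h x u y v a b.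
have s0 : sigma != 0 by case: hsigma => ->; rewrite ?oppr_eq0 oner_eq0.
have : sigma * qval Q u y v x b a == 0 by rewrite -q2 q0.
by rewrite mulf_eq0 (negPf s0) /= => /eqP q3; rewrite q1 q3 mulr0.
Qed.

End Symmetry.

(** * Transport along walks *)

Section Transport.
Context {R : realType} {V : countType} (D : quad_graph V).
Variables (alpha : V -> V -> R[i]) (Q : quad_poly R) (f : V -> R[i]).
Variable lambda : R[i].

(** A relation, since the equation may have no solution [s'] or several; [transport] is relational
    for the same reason. *)
Definition step x u s s' : Prop :=
  edge D x u /\ qval Q (f x) (f u) s' s (alpha x u) lambda = 0.

Fixpoint transport x p s s' : Prop :=
  if p is u :: p' then exists2 r, step x u s r & transport u p' r s'
  else s' = s.

Lemma transport_cat x p q s s' :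
  transport x (p ++ q) s s' <->
  exists2 r, transport x p s r & transport (last x p) q r s'.
Proof.
elim: p x s => [|u p IHp] x s /=; first by split=> [|[r ->]] //; exists s.
split=> [[r h /IHp[r' h1 h2]]|[r' [r h h1] h2]].
  by exists r' => //; exists r.
by exists r => //; apply/IHp; exists r'.
Qed.

(** [transported] extends a walk at its end while [transport] recurses from its start;
    [transport_cat] reconciles the two. *)
Lemma transportedP v0 t x s :
  transported D alpha Q lambda f v0 t x s <->
  exists2 p, last v0 p = x & transport v0 p t s.
Proof.
split=> [|[p <-]].
  elim=> [|y u r r' _ [p <- h] yu q0]; first by exists [::].
  exists (rcons p u); first by rewrite last_rcons.
  by rewrite -cats1; apply/transport_cat; exists r => //; exists r'.
elim/last_ind: p s => [|p u IHp] s /= h; first by rewrite h; constructor.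
move: h; rewrite last_rcons -cats1.
case/transport_cat=> r /IHp h [r' [e q0] ->].
exact: transported_step h e q0.
Qed.

(** * Independence of the walk, and the resulting solution *)

Section Consistent.
Hypotheses (labelD : labelling D alpha) (symQ : quad_symmetric Q).

Lemma step_sym x u s s' : step x u s s' -> step u x s' s.
Proof.
case: labelD => lsym _ [xu q0]; split; first exact: edge_sym.
by rewrite -(lsym _ _ xu); apply: qval_flip.
Qed.

(** [rev (belast x p)] is the reversed walk without its new starting vertex [last x p]. *)
Lemma transport_sym x p s s' :
  transport x p s s' -> transport (last x p) (rev (belast x p)) s' s.
Proof.
elim: p x s => [|u p IHp] x s /= => [-> //|[r h /IHp h1]].
rewrite rev_cons -cats1; apply/transport_cat; exists r => //.
have -> : last (last u p) (rev (belast u p)) = u.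
  by case: (p) => //= w p'; rewrite rev_cons last_rcons.
by exists s => //; apply: step_sym.
Qed.

Hypotheses (consQ : consistent3D Q) (solf : solution D alpha Q f)
  (regf : regular D alpha Q f).
Context {v0 : V} {t : R[i]}.
Hypothesis pf : pole_free D alpha Q lambda f v0 t.

Notation reached := (transported D alpha Q lambda f v0 t).

Lemma reached_step x u s s' : reached x s -> step x u s s' -> reached u s'.
Proof. by move=> h [xu q0]; apply: transported_step h xu q0. Qed.

Lemma reached_transport x p s s' :
  reached x s -> transport x p s s' -> reached (last x p) s'.
Proof.
elim: p x s => [|u p IHp] x s h /= => [-> //|[r hr]].
by apply: IHp; apply: reached_step hr.
Qed.

(** [pole_free] grants uniqueness only at values obtained from [t], whence the [reached] hypotheses
    from here on. *)
Lemma step_fun x u s s1 s2 :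
  reached x s -> step x u s s1 -> step x u s s2 -> s1 = s2.
Proof.
by move=> h [xu q1] [_ q2]; case: (pf h xu) => r [_ ur];
  rewrite -(ur s1) ?(ur s2).
Qed.

Lemma step_total x u s : reached x s -> edge D x u -> exists s', step x u s s'.
Proof. by move=> h xu; case: (pf h xu) => r [q0 _]; exists r. Qed.

Lemma transport_fun x p s s1 s2 :
  reached x s -> transport x p s s1 -> transport x p s s2 -> s1 = s2.
Proof.
elim: p x s => [|u p IHp] x s h /= => [-> -> //|[r hr h1] [r' hr' h2]].
have e := step_fun h hr hr'; subst r'.
exact: IHp (reached_step h hr) h1 h2.
Qed.

Lemma transport_total x p s :
  reached x s -> path (edge D) x p -> exists s', transport x p s s'.
Proof.
elim: p x s => [|u p IHp] x s h /=; first by exists s.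
case/andP=> xu up; have [r hr] := step_total h xu.
have [s' h'] := IHp _ _ (reached_step h hr) up.
by exists s', r.
Qed.

(* The cube has the face [x u y v] as bottom and the values [s], [su], [sv],
   [sy] of [f+] on top; the last conclusion is its top face. *)
Lemma step_face x u y v s su sv sy :
    face D x u y v -> reached x s ->
    step x u s su -> step x v s sv -> step u y su sy ->
  step v y sv sy /\ qval Q s su sy sv (alpha x u) (alpha x v) = 0.
Proof.
case: labelD => lsym lface F hs hu hv hy.
have Fr := face_refl F.
have vy : edge D v y by apply: face_edge (face_rot Fr).
have uy : edge D u y by apply: face_edge (face_rot F).
have auy : alpha u y = alpha x v by rewrite (lface _ _ _ _ Fr).
have avy : alpha v y = alpha x u by rewrite (lface _ _ _ _ F).
have uniq_step a b r r' : reached a r -> step a b r r' ->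
    unique (fun z => qval Q (f a) (f b) z r (alpha a b) lambda = 0) r'.
  move=> ha hb; split=> [|z hz]; first by case: hb.
  by have [ab _] := hb; apply: (step_fun ha hb).
have [_ _ [z [_ hz]] _] := regf F.
have U12 : unique (fun z => qval Q (f x) (f u) z (f v)
    (alpha x u) (alpha x v) = 0) (f y).
  split=> [|z' hz']; first exact: solf.
  by rewrite -(hz (f y)) ?(hz z') //; apply: solf.
have U13 := uniq_step _ _ _ _ hs hu; have U23 := uniq_step _ _ _ _ hs hv.
have UE1 := uniq_step _ _ _ _ (reached_step hs hu) hy.
rewrite auy in UE1.
(* Directions 1 and 2 are those of [x u] and [x v]; direction 3 is vertical, with [a3 = lambda],
   [f3 = s], [f123 = sy]. The side over [u y] determines [sy]; the second equation is the side over
   [v y], the third the top. *)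
have [|_ E2 E3] := consQ U12 U13 U23 (f123 := sy); first by left.
by split=> //; split=> //; rewrite avy.
Qed.

Lemma transport_face x u y v q s s' :
    face D x u y v -> reached x s ->
  transport x [:: u, y & q] s s' -> transport x [:: v, y & q] s s'.
Proof.
move=> F hs /= [su hu [sy hy h]].
have xv : edge D x v by apply: face_edge (face_refl F).
have [sv hv] := step_total hs xv.
by exists sv => //; exists sy => //; have [] := step_face F hs hu hv hy.
Qed.

(** By [step_sym] the way back may return to [s]; by uniqueness it must. *)
Lemma transport_backtrack x u q s s' :
    edge D x u -> reached x s ->
  transport x q s s' <-> transport x [:: u, x & q] s s'.
Proof.
move=> xu hs; split=> /= [h|[r hr [s1 h1 h]]].
  have [r hr] := step_total hs xu.
  by exists r => //; exists s => //; apply: step_sym.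
by rewrite (step_fun (reached_step hs hr) (step_sym hr) h1).
Qed.

(** [homotopic] compares vertex lists that include the start, which [transport] takes separately;
    [v0] is only the default for the empty list. *)
Definition transport_seq l : R[i] -> R[i] -> Prop :=
  transport (head v0 l) (behead l).

(** An elementary homotopy changes a walk only after some vertex [x], and the values arriving there
    are reached, as the local lemmas require. *)
Lemma transport_seq_cat p x q q' :
    (forall s s', reached x s -> transport x q s s' <-> transport x q' s s') ->
  forall s s', reached (head v0 (p ++ [:: x])) s ->
  transport_seq (p ++ x :: q) s s' <-> transport_seq (p ++ x :: q') s s'.
Proof.
case: p => [|a p] qq' s s' /= hs; first exact: qq'.
rewrite /transport_seq /= -(cat1s x q) -(cat1s x q') !catA.
have e r (hr : transport a (p ++ [:: x]) s r) := reached_transport hs hr.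
rewrite last_cat /= in e.
by split=> /transport_cat[r hr]; rewrite last_cat /= => h;
  apply/transport_cat; exists r => //; rewrite last_cat /=; apply/qq'; auto.
Qed.

(** Equality of the heads is carried through the induction so that the [reached] hypothesis passes
    through symmetry and transitivity. *)
Lemma transport_homotopic l l' : homotopic D l l' ->
  head v0 l = head v0 l' /\
  forall s s', reached (head v0 l) s ->
    transport_seq l s s' <-> transport_seq l' s s'.
Proof.
elim=> {l l'} [l //|l l' _ [e h]|l1 l2 l3 _ [e12 h12] _ [e23 h23]
              |p q x u xu|p q x u y v F].
- by split=> // s s' hs; rewrite h // e.
- split=> [|s s' hs]; first by rewrite e12.
  by rewrite h12 // h23 // -e12.
- split=> [|s s' hs]; first by case: p.
  apply: (@transport_seq_cat p x q [:: u, x & q]) => [r r'|].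
    exact: transport_backtrack.
  by case: p hs.
- split=> [|s s' hs]; first by case: p.
  apply: (@transport_seq_cat p x [:: u, y & q] [:: v, y & q]) => [r r' hr|].
    (* The converse is the same face with [u] and [v] exchanged. *)
    split; apply: transport_face => //; exact: face_refl.
  by case: p hs.
Qed.

Lemma transport_path x p s s' : transport x p s s' -> path (edge D) x p.
Proof. by elim: p x s => [|u p IHp] x s //= [r [-> _] /IHp]. Qed.

Hypothesis scD : simply_connected D.

(** Monodromy: carry [s1] back along the reverse of [p2] to some [r]. The closed walk so formed is
    contractible, hence [r = t]; reversing again, [p2] carries [t] to [s1] as well as to [s2]. *)
Lemma reached_inj x s1 s2 : reached x s1 -> reached x s2 -> s1 = s2.
Proof.
move=> h1 h2; have start := transported_start D alpha Q lambda f v0 t.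
case/transportedP: (h1) => p1 l1 t1; case/transportedP: (h2) => p2 l2 t2.
have r2 := transport_sym t2; rewrite l2 in r2.
have lr : last x (rev (belast v0 p2)) = v0.
  by case: (p2) l2 => [|a p'] //= _; rewrite rev_cons last_rcons.
have [r hr] := transport_total h1 (transport_path r2).
have closed : transport v0 (p1 ++ rev (belast v0 p2)) t r.
  by apply/transport_cat; exists s1; rewrite // l1.
have hom : homotopic D (v0 :: p1 ++ rev (belast v0 p2)) [:: v0].
  by apply: scD; [exact: transport_path closed|rewrite last_cat l1].
have [_ /(_ t r start)[/(_ closed) rt _]] := transport_homotopic hom.
rewrite /transport_seq /= in rt; subst r.
have := transport_sym hr; rewrite lr.
(* Reversing twice restores [p2]; this is checked on the lists with the start [v0] attached. *)
have -> : rev (belast x (rev (belast v0 p2))) = p2.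
  have := congr1 rev (lastI v0 p2).
  rewrite l2 rev_rcons => e.
  have : rcons (belast x (rev (belast v0 p2))) v0 = rev (v0 :: p2).
    by rewrite e [RHS]lastI lr.
  by move/(congr1 rev); rewrite rev_rcons revK => -[].
move=> t2'; exact: transport_fun start t2' t2.
Qed.

Lemma reached_total x : exists s, reached x s.
Proof.
have [p [pp <-]] := graph_connected D v0 x.
have start := transported_start D alpha Q lambda f v0 t.
have [s h] := transport_total start pp.
by exists s; apply: reached_transport h.
Qed.

(** Each vertex has exactly one reached value, and these values form [fp]. *)
Lemma backlund_exists_unique :
  exists! fp : V -> R[i],
    [/\ solution D alpha Q fp, backlund D alpha Q lambda f fp & fp v0 = t].
Proof.
have [fp hfp] := choice reached_total.
have fp_step x u : edge D x u -> step x u (fp x) (fp u).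
  move=> xu; have [s' h] := step_total (hfp x) xu.
  by rewrite -(reached_inj (reached_step (hfp x) h) (hfp u)).
exists fp; split=> [|fp' [_ blfp' fp'0]]; first split.
- move=> x u y v F.
  apply: proj2 (step_face F (hfp x) _ _ _); apply: fp_step.
  + exact: face_edge F.
  + exact: face_edge (face_refl F).
  + exact: face_edge (face_rot F).
- by move=> x u /fp_step[].
- by apply: reached_inj (hfp v0) _; constructor.
(* The equations relating [f] and [fp'] are steps, so along any walk from [v0] the values of [fp']
   are reached too. *)
have walk q y : path (edge D) y q -> reached y (fp' y) ->
    reached (last y q) (fp' (last y q)).
  elim: q y => [|u q IHq] y //= /andP[yu uq] h.
  by apply: IHq => //; apply: reached_step h _; split=> //; apply: blfp'.
apply/funext=> x; apply: reached_inj (hfp x) _.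
have [p [pp <-]] := graph_connected D v0 x.
by apply: walk => //; rewrite fp'0; constructor.
Qed.

End Consistent.

(** * Exceptional initial values *)

Section Poles.
Hypotheses (affQ : multiaffine Q)
  (nondeg : edge_nondegenerate D alpha Q lambda f).

Lemma step_affine x u s s' :
  let q s' s := qval Q (f x) (f u) s' s (alpha x u) lambda in
  q s' s = (1 - s') * ((1 - s) * q 0 0 + s * q 0 1)
           + s' * ((1 - s) * q 1 0 + s * q 1 1).
Proof.
move=> /=; rewrite qval_affine_y //.
by congr (_ * _ + _ * _); rewrite qval_affine_v.
Qed.

Lemma step_inj x u s1 s2 s' : step x u s1 s' -> step x u s2 s' -> s1 = s2.
Proof.
case=> xu q1 [_ q2]; rewrite step_affine in q1; rewrite step_affine in q2.
apply/eqP; apply: contra_notT (nondeg xu) => s12.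
exact: bilinear_degenerate_l s12 q1 q2.
Qed.

Lemma transport_inj x p s1 s2 s' :
  transport x p s1 s' -> transport x p s2 s' -> s1 = s2.
Proof.
elim: p x s1 s2 => [|u p IHp] x s1 s2 /= => [-> -> //|[r1 h1 t1] [r2 h2 t2]].
by move: h2; rewrite -(IHp _ _ _ t1 t2); apply: step_inj.
Qed.

(** On a nondegenerate edge this is the point sent to infinity by the fractional linear map from [s]
    to [s']. *)
Definition pole x u s : Prop :=
  edge D x u /\
  ~ exists! s', qval Q (f x) (f u) s' s (alpha x u) lambda = 0.

(** At a pole the coefficient [q 1 s - q 0 s] of [s'] vanishes; it is affine in [s], and two zeros
    would make the edge degenerate. *)
Lemma pole_unique x u s1 s2 : pole x u s1 -> pole x u s2 -> s1 = s2.
Proof.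
pose q s' s := qval Q (f x) (f u) s' s (alpha x u) lambda.
have poleE s : pole x u s -> q 1 s = q 0 s.
  case=> _ np; apply/eqP; apply: contra_notT np => ne.
  have qE s' : q s' s = q 0 s + s' * (q 1 s - q 0 s).
    by rewrite /q qval_affine_y //; ring.
  have ne0 : q 1 s - q 0 s != 0 by rewrite subr_eq0.
  exists (- q 0 s / (q 1 s - q 0 s)); split.
    by rewrite -/(q _ s) qE divfK // subrr.
  move=> s'; rewrite -/(q s' s) qE => /eqP.
  by rewrite addrC addr_eq0 => /eqP e; apply: (mulIf ne0); rewrite divfK.
have qE s' s : q s' s = (1 - s) * q s' 0 + s * q s' 1.
  by rewrite /q qval_affine_v.
move=> h1 h2; have [xu _] := h1.
move: (poleE _ h1) (poleE _ h2); rewrite !(qE _ s1) !(qE _ s2) => e1 e2.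
apply/eqP; apply: contra_notT (nondeg xu) => s12.
exact: bilinear_degenerate_r s12 e1 e2.
Qed.

Lemma countable_poles v0 :
  countable [set t : R[i] | ~ pole_free D alpha Q lambda f v0 t].
Proof.
(* A bad [t] is carried by a walk [pu.1] to a pole of the edge from its end to [pu.2]; there are
   countably many such pairs. *)
pose B (pu : seq V * V) : set R[i] :=
  [set t | exists2 s, transport v0 pu.1 t s & pole (last v0 pu.1) pu.2 s].
have sub : [set t | ~ pole_free D alpha Q lambda f v0 t]
    `<=` \bigcup_(pu in [set: seq V * V]) B pu.
  move=> t /= npf; apply: contrapT => nB; apply: npf => x u s /transportedP.
  case=> p <- h xu; apply: contrapT => np.
  by apply: nB; exists (p, u) => //; exists s.
apply: sub_countable (subset_card_le sub) _.
apply: bigcup_countable => // pu _.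
(* The edge fixes the pole, and injectivity of transport pulls it back to a single [t]. *)
have subB : forall t1 t2, B pu t1 -> B pu t2 -> t1 = t2.
  move=> t1 t2 [r1 h1 p1] [r2 h2 p2].
  rewrite -(pole_unique p1 p2) in h2; exact: transport_inj h1 h2.
have [->|/set0P[t Bt]] := eqVneq (B pu) set0; first exact: countable0.
apply: (sub_countable _ (countable1 t)); apply: subset_card_le => r Br.
exact: subB.
Qed.

End Poles.
End Transport.

Theorem theorem4p2 (R : realType) (V : countType) (D : quad_graph V)
    (alpha : V -> V -> R[i]) (Q : quad_poly R) (f : V -> R[i]) :
  simply_connected D ->
  labelling D alpha ->
  multiaffine Q ->
  quad_symmetric Q ->
  consistent3D Q ->
  solution D alpha Q f ->
  regular D alpha Q f ->
  forall (lambda : R[i]) (v0 : V),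
    (forall t : R[i], pole_free D alpha Q lambda f v0 t ->
       exists! fp : V -> R[i],
         [/\ solution D alpha Q fp, backlund D alpha Q lambda f fp &
             fp v0 = t]) /\
    (edge_nondegenerate D alpha Q lambda f ->
       countable [set t : R[i] | ~ pole_free D alpha Q lambda f v0 t]).
Proof.
move=> scD labelD affQ symQ consQ solf regf lambda v0; split=> [t pf|nondeg].
  exact: backlund_exists_unique.
exact: countable_poles.
Qed.
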